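(* Let $T$ be a complete theory with monster model $\mathbb M$ and let $\mathrm{cl}$ be an existential matroid on $\mathbb M$. If $\mathbb M$ expands a field, then $\mathbb M$ is a perfect field. In particular, the theory of separably closed, non-algebraically closed fields and the theory of differentially closed fields of finite (i.e. positive) characteristic do not admit an existential matroid (no monster model of a completion of either theory carries an existential matroid).
   Context: Conventions: $T$ is a complete first-order theory in a language $\mathcal L$ with only infinite models; $\kappa>|T|$ is a large cardinal; $\mathbb M$ is a monster model, i.e. a $\kappa$-saturated, strongly $\kappa$-homogeneous model of $T$. ''Small'' means of cardinality $<\kappa$. A (finitary) matroid on $\mathbb M$ is an operator $\mathrm{cl}:\mathcal P(\mathbb M)\to\mathcal P(\mathbb M)$ with: $X\subseteq \mathrm{cl}(X)$; $X\subseteq Y\Rightarrow \mathrm{cl}(X)\subseteq \mathrm{cl}(Y)$; $\mathrm{cl}(\mathrm{cl}(X))=\mathrm{cl}(X)$; $\mathrm{cl}(X)=\bigcup\{\mathrm{cl}(A): A\subseteq X \text{ finite}\}$; and the exchange principle: $a\in \mathrm{cl}(X\cup\{c\})\setminus \mathrm{cl}(X)$ implies $c\in\mathrm{cl}(X\cup\{a\})$. An $\mathcal L$-formula $\phi(x,\bar y)$ without parameters, $x$ a single variable, is $x$-narrow if for all $a,\bar b$, $\mathbb M\models\phi(a,\bar b)$ implies $a\in\mathrm{cl}(\bar b)$. The matroid is definable if for every $A$, $\mathrm{cl}(A)$ is the union of the sets $\phi(\mathbb M,\bar a)$ with $\phi(x,\bar y)$ $x$-narrow and $\bar a$ a finite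 tuple from $A$. It satisfies Existence if for every element $a$ and all small $B,C$ with $a\notin\mathrm{cl}(B)$ there is $a'$ with the same type as $a$ over $B$ and $a'\notin\mathrm{cl}(B\cup C)$. The trivial matroid is $\mathrm{cl}^0(X)=\mathbb M$ for all $X$. An existential matroid is a definable matroid that satisfies Existence and is not the trivial matroid.
   Formalization: The two theories are taken in each fixed characteristic p (p prime for differentially closed fields); taken over all characteristics at once they have completions of characteristic 0, such as ACF_0, that do admit an existential matroid. *)

(* Defs.v *)
From mathcomp Require Import all_boot all_algebra separable.
From mathcomp Require Import mathcomp_extra boolp classical_sets functions.
From mathcomp Require Import cardinality.

Set Implicit Arguments.
Unset Strict Implicit.
Unset Printing Implicit Defensive.

Import GRing.Theory.

Local Open Scope classical_set_scope.
Local Open Scope ring_scope.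
Local Open Scope card_scope.

Definition card_lt (T U : Type) (A : set T) (B : set U) : Prop :=
  (A #<= B) /\ ~ (B #<= A).

Definition vnil (X : Type) : 'I_0 -> X :=
  fun i => match notF (ltn_ord i) with end.

Definition vcons (X : Type) (n : nat) (a : X) (b : 'I_n -> X) : 'I_n.+1 -> X :=
  fun i => if unlift ord0 i is Some j then b j else a.

Definition vcat (X : Type) (m n : nat) (a : 'I_m -> X) (b : 'I_n -> X) :
    'I_(m + n) -> X :=
  fun i => match fintype.split i with inl j => a j | inr j => b j end.

(** * First-order logic *)

Record language : Type := Language {
  funsym : Type;
  funsym_arity : funsym -> nat;
  relsym : Type;
  relsym_arity : relsym -> nat
}.

(* [term L n] and [formula L n] only use the variables indexed by ['I_n]. *)
Inductive term (L : language) (n : nat) : Type :=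
  | Var (i : 'I_n)
  | App (f : funsym L) (args : 'I_(funsym_arity f) -> term L n).

(* The quantifier of [All phi] binds the variable of index 0 of [phi]; the
   variable of index [i] of [All phi] is the variable of index [i.+1] of
   [phi]. *)
Inductive formula (L : language) : nat -> Type :=
  | Bot n : formula L n
  | Eq n (t1 t2 : term L n) : formula L n
  | Rel n (r : relsym L) (args : 'I_(relsym_arity r) -> term L n) :
      formula L n
  | Imp n (phi1 phi2 : formula L n) : formula L n
  | All n (phi : formula L n.+1) : formula L n.

Definition sentence (L : language) : Type := formula L 0.

Definition theory (L : language) : Type := set (sentence L).

Definition Not (L : language) (n : nat) (phi : formula L n) : formula L n :=
  Imp phi (Bot L n).

Fixpoint quantifier_free (L : language) (n : nat) (phi : formula L n) : Prop :=
  match phi with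
  | Bot _ | Eq _ _ _ | Rel _ _ _ => True
  | Imp _ phi1 phi2 => quantifier_free phi1 /\ quantifier_free phi2
  | All _ _ => False
  end.

Record structure (L : language) : Type := Structure {
  carrier :> Type;
  carrier_inhabited : inhabited carrier;
  func_interp : forall f : funsym L, ('I_(funsym_arity f) -> carrier) -> carrier;
  rel_interp : forall r : relsym L, ('I_(relsym_arity r) -> carrier) -> Prop
}.

Fixpoint eval (L : language) (M : structure L) (n : nat) (v : 'I_n -> M)
    (t : term L n) : M :=
  match t with
  | Var i => v i
  | App f args => func_interp (fun j => eval v (args j))
  end.

Fixpoint sat (L : language) (M : structure L) (n : nat) (phi : formula L n) :
    ('I_n -> M) -> Prop :=
  match phi in formula _ n return ('I_n -> M) -> Prop with
  | Bot _ => fun _ => False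
  | Eq _ t1 t2 => fun v => eval v t1 = eval v t2
  | Rel _ r args => fun v => rel_interp (fun j => eval v (args j))
  | Imp _ phi1 phi2 => fun v => sat phi1 v -> sat phi2 v
  | All _ phi1 => fun v => forall a : M, sat phi1 (vcons a v)
  end.

Definition holds (L : language) (M : structure L) (s : sentence L) : Prop :=
  sat s (@vnil M).

Definition model (L : language) (T : theory L) (M : structure L) : Prop :=
  forall s, T s -> holds M s.

Definition entails (L : language) (T : theory L) (s : sentence L) : Prop :=
  forall M : structure L, model T M -> holds M s.

Definition complete_theory (L : language) (T : theory L) : Prop :=
  (exists M : structure L, model T M) /\
  forall s, entails T s \/ entails T (Not s).

Definition completion (L : language) (T0 T : theory L) : Prop :=
  complete_theory T /\ forall s, T0 s -> entails T s.

(** * Monster models *)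

(* A cardinal is given by a type [kappa] of that cardinality. *)
Definition small (kappa X : Type) (A : set X) : Prop :=
  card_lt A [set: kappa].

Record param_formula (L : language) (M : structure L) : Type := ParamFormula {
  pf_arity : nat;
  pf_formula : formula L pf_arity.+1;
  pf_params : 'I_pf_arity -> M
}.

Arguments pf_params {L M} p _.

Definition params_in (L : language) (M : structure L) (A : set M)
    (q : param_formula M) : Prop :=
  forall i, A (pf_params q i).

Definition realizes (L : language) (M : structure L) (a : M)
    (q : param_formula M) : Prop :=
  sat (pf_formula q) (vcons a (pf_params q)).

Definition saturated (L : language) (kappa : Type) (M : structure L) : Prop :=
  forall (A : set M) (G : set (param_formula M)),
    small kappa A -> G `<=` params_in A ->
    (forall S : set (param_formula M), finite_set S -> S `<=` G ->
       exists a : M, S `<=` realizes a) ->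
    exists a : M, G `<=` realizes a.

Definition elementary_on (L : language) (M : structure L) (A : set M)
    (f : M -> M) : Prop :=
  forall (n : nat) (phi : formula L n) (a : 'I_n -> M), (forall i, A (a i)) ->
    (sat phi a <-> sat phi (f \o a)).

Definition automorphism (L : language) (M : structure L) (s : M -> M) : Prop :=
  [/\ bijective s,
      forall (f : funsym L) (a : 'I_(funsym_arity f) -> M),
        s (func_interp a) = func_interp (s \o a) &
      forall (r : relsym L) (a : 'I_(relsym_arity r) -> M),
        rel_interp a <-> rel_interp (s \o a)].

Definition strongly_homogeneous (L : language) (kappa : Type)
    (M : structure L) : Prop :=
  forall (A : set M) (f : M -> M), small kappa A -> elementary_on A f ->
    exists s : M -> M, automorphism s /\ forall a, A a -> s a = f a.

(* [|T|] is the number of formulas of the language, i.e. the maximum of its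
   cardinality and aleph_0; in particular [kappa] is uncountable. *)
Record monster_model (L : language) (kappa : Type) (T : theory L)
    (M : structure L) : Prop := MonsterModel {
  monster_infinite_models :
    forall N : structure L, model T N -> infinite_set [set: N];
  monster_card : card_lt [set: {n : nat & formula L n}] [set: kappa];
  monster_is_model : model T M;
  monster_saturated : saturated kappa M;
  monster_homogeneous : strongly_homogeneous kappa M
}.

(** * Existential matroids *)

Record matroid (X : Type) (cl : set X -> set X) : Prop := Matroid {
  cl_ext : forall A, A `<=` cl A;
  cl_mono : forall A B, A `<=` B -> cl A `<=` cl B;
  cl_idem : forall A, cl (cl A) = cl A;
  cl_finitary : forall A,
    cl A = \bigcup_(B in [set B | finite_set B /\ B `<=` A]) cl B;
  cl_exchange : forall A a c,
    cl (A `|` [set c]) a -> ~ cl A a -> cl (A `|` [set a]) c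
}.

(* The variable x is the one of index 0. *)
Definition narrow (L : language) (M : structure L) (cl : set M -> set M)
    (n : nat) (phi : formula L n.+1) : Prop :=
  forall (a : M) (b : 'I_n -> M), sat phi (vcons a b) -> cl (range b) a.

Definition definable_matroid (L : language) (M : structure L)
    (cl : set M -> set M) : Prop :=
  forall A : set M,
    cl A = [set x | exists (n : nat) (phi : formula L n.+1) (a : 'I_n -> M),
              [/\ narrow cl phi, forall i, A (a i) & sat phi (vcons x a)]].

Definition same_type (L : language) (M : structure L) (B : set M) (a a' : M) :
    Prop :=
  forall q : param_formula M, params_in B q -> (realizes a q <-> realizes a' q).

Definition existence (L : language) (kappa : Type) (M : structure L)
    (cl : set M -> set M) : Prop :=
  forall (a : M) (B C : set M), small kappa B -> small kappa C -> ~ cl B a ->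
    exists a' : M, same_type B a a' /\ ~ cl (B `|` C) a'.

Definition trivial_matroid (X : Type) : set X -> set X := fun=> setT.

Record existential_matroid (L : language) (kappa : Type) (M : structure L)
    (cl : set M -> set M) : Prop := ExistentialMatroid {
  existential_is_matroid : matroid cl;
  existential_definable : definable_matroid cl;
  existential_existence : existence kappa cl;
  existential_nontrivial : cl <> @trivial_matroid M
}.

(** * Fields *)

Definition perfect_field (F : fieldType) : Prop :=
  forall p : nat, p \in [pchar F] -> forall x : F, exists y : F, y ^+ p = x.

(* The field [F], whose universe is identified with that of [M] by the bijection
   [iota], is a reduct of [M]: its addition and its multiplication (hence also
   0, 1, opposite and inverse) are definable without parameters in [M].  This
   holds in particular when + and * are symbols of [L]. *)
Record expands_field (L : language) (M : structure L) (F : fieldType)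
    (iota : F -> M) : Prop := ExpandsField {
  expands_bijective : bijective iota;
  expands_add : exists phi : formula L 3, forall x y z : F,
    sat phi (vcons (iota x) (vcons (iota y) (vcons (iota z) (@vnil M))))
    <-> x + y = z;
  expands_mul : exists phi : formula L 3, forall x y z : F,
    sat phi (vcons (iota x) (vcons (iota y) (vcons (iota z) (@vnil M))))
    <-> x * y = z
}.

Inductive ring_func : Type := RZero | ROne | ROpp | RAdd | RMul.

Definition ring_arity (f : ring_func) : nat :=
  match f with RZero | ROne => 0 | ROpp => 1 | RAdd | RMul => 2 end.

Definition ring_language : language :=
  @Language ring_func ring_arity void (fun r => match r with end).

Definition ring_interp (F : fieldType) (f : ring_func) :
    ('I_(ring_arity f) -> F) -> F :=
  match f return ('I_(ring_arity f) -> F) -> F with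
  | RZero => fun=> 0
  | ROne => fun=> 1
  | ROpp => fun v => - v ord0
  | RAdd => fun v => v ord0 + v ord_max
  | RMul => fun v => v ord0 * v ord_max
  end.

Definition field_structure (F : fieldType) : structure ring_language :=
  @Structure ring_language F (inhabits 0) (@ring_interp F)
    (fun r => match r with end).

Definition has_characteristic (F : fieldType) (p : nat) : Prop :=
  forall n : nat, n%:R = 0 :> F <-> (p %| n)%N.

Definition separably_closed (F : fieldType) : Prop :=
  forall f : {poly F}, (1 < size f)%N -> separable_poly f ->
    exists x : F, root f x.

Definition algebraically_closed (F : fieldType) : Prop :=
  forall f : {poly F}, (1 < size f)%N -> exists x : F, root f x.

(* The characteristic is fixed because the class of all separably closed,
   non-algebraically closed fields is not elementary: an ultraproduct of such
   fields of unbounded characteristics is algebraically closed.  In a fixed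
   characteristic the class is elementary, and its theory is the set of the
   sentences that hold in all its members. *)
Definition SCF_nonACF (p : nat) : theory ring_language :=
  [set s | forall F : fieldType, has_characteristic F p ->
     separably_closed F -> ~ algebraically_closed F ->
     holds (field_structure F) s].

(** * Differential fields *)

Definition derivation (K : fieldType) (d : K -> K) : Prop :=
  {morph d : x y / x + y} /\ forall x y, d (x * y) = d x * y + x * d y.

(* [None] is the symbol for the derivation. *)
Definition diff_arity (f : option ring_func) : nat :=
  if f is Some g then ring_arity g else 1.

Definition diff_language : language :=
  @Language (option ring_func) diff_arity void (fun r => match r with end).

Definition diff_interp (K : fieldType) (d : K -> K) (f : option ring_func) :
    ('I_(diff_arity f) -> K) -> K :=
  match f return ('I_(diff_arity f) -> K) -> K with
  | Some g => @ring_interp K g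
  | None => fun v => d (v ord0)
  end.

Definition diff_structure (K : fieldType) (d : K -> K) :
    structure diff_language :=
  @Structure diff_language K (inhabits 0) (diff_interp d)
    (fun r => match r with end).

(* The differentially closed fields are the existentially closed differential
   fields: every finite system of differential equations and inequations over
   [K] that is solvable in a differential field extension of [K] is solvable
   in [K]. *)
Definition differentially_closed (K : fieldType) (d : K -> K) : Prop :=
  derivation d /\
  forall (F : fieldType) (dF : F -> F) (h : {rmorphism K -> F}),
    derivation dF -> (forall x, h (d x) = dF (h x)) ->
    forall (m n : nat) (phi : formula diff_language (m + n)) (b : 'I_n -> K),
      quantifier_free phi ->
      (exists a : 'I_m -> F,
         @sat _ (diff_structure dF) _ phi (vcat a (h \o b))) ->
      exists a : 'I_m -> K, @sat _ (diff_structure d) _ phi (vcat a b).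

(* In characteristic [p > 0] the existentially closed differential fields form
   an elementary class (Wood), whose theory DCF_p is the model companion of the
   theory of differential fields of characteristic [p]. *)
Definition DCF (p : nat) : theory diff_language :=
  [set s | forall (K : fieldType) (d : K -> K), has_characteristic K p ->
     differentially_closed d -> holds (diff_structure d) s].

(* Main.v *)
Require Import Defs.
From HB Require Import structures.
From mathcomp Require Import all_boot all_algebra separable.
From mathcomp Require Import mathcomp_extra boolp classical_sets functions.
From mathcomp Require Import cardinality generic_quotient fraction ring.

(* If c has no p-th root in characteristic p, then (x, y) |-> x^p + c y^p is
   injective, so x and y are definable over c and z = x^p + c y^p.  By Existence
   dcl is contained in cl, and x, y can be chosen with x not in cl(c) and y not in
   cl(c, x).  Exchange turns x in cl(c, z) into z in cl(c, x), whence
   y in cl(c, z) is contained in cl(c, x), a contradiction.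
   A perfect separably closed field is algebraically closed, and a differentially
   closed field of characteristic p has an element x with dx <> 0, which is not a
   p-th power; so the models of the two theories are imperfect fields. *)

Set Implicit Arguments.
Unset Strict Implicit.
Unset Printing Implicit Defensive.

Import GRing.Theory.

Local Open Scope classical_set_scope.
Local Open Scope ring_scope.
Local Open Scope card_scope.

(** * Assignments, renaming of variables, and automorphisms *)

Lemma vcons0 (X : Type) (n : nat) (a : X) (b : 'I_n -> X) :
  vcons a b ord0 = a.
Proof. by rewrite /vcons unlift_none. Qed.

Lemma vconsS (X : Type) (n : nat) (a : X) (b : 'I_n -> X) (i : 'I_n) :
  vcons a b (lift ord0 i) = b i.
Proof. by rewrite /vcons liftK. Qed.

Lemma vcons_comp (X Y : Type) (f : X -> Y) (n : nat) (a : X) (b : 'I_n -> X) :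
  f \o vcons a b = vcons (f a) (f \o b).
Proof.
by apply: funext => i; case: (unliftP ord0 i) => [j|] -> /=;
  rewrite ?vconsS ?vcons0.
Qed.

Lemma comp_vnil (X Y : Type) (f : X -> Y) : f \o @vnil X = @vnil Y.
Proof. by apply: funext => -[]. Qed.

Fixpoint term_rename (L : language) (n m : nat) (f : 'I_n -> 'I_m)
    (t : term L n) : term L m :=
  match t with
  | Var i => Var L (f i)
  | App g args => App (fun j => term_rename f (args j))
  end.

(** The map of variables need not be injective: [same_type_elementary] merges several variables into
    one. *)
Fixpoint rename (L : language) (n : nat) (phi : formula L n) :
    forall m : nat, ('I_n -> 'I_m) -> formula L m :=
  match phi in formula _ n return forall m : nat, ('I_n -> 'I_m) -> formula L m
  with
  | Bot n => fun m _ => Bot L m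
  | Eq n t1 t2 => fun m f => Eq (term_rename f t1) (term_rename f t2)
  | Rel n r args => fun m f => Rel (fun j => term_rename f (args j))
  | Imp n phi1 phi2 => fun m f => Imp (rename phi1 f) (rename phi2 f)
  | All n phi1 => fun m f =>
      All (rename phi1 (vcons ord0 (fun i => lift ord0 (f i))))
  end.

Lemma eval_rename (L : language) (M : structure L) (n m : nat)
    (f : 'I_n -> 'I_m) (t : term L n) (v : 'I_m -> M) :
  eval v (term_rename f t) = eval (v \o f) t.
Proof.
by elim: t => //= g args IH; congr func_interp; apply: funext => j; exact: IH.
Qed.

Lemma sat_rename (L : language) (M : structure L) (n : nat)
    (phi : formula L n) (m : nat) (f : 'I_n -> 'I_m) (v : 'I_m -> M) :
  sat (rename phi f) v <-> sat phi (v \o f).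
Proof.
elim: phi m f v => {n} [n|n t1 t2|n r args|n phi1 IH1 phi2 IH2|n phi IH] m f v //=.
- by rewrite !eval_rename.
- by under eq_fun do rewrite eval_rename.
- by rewrite IH1 IH2.
- have E a : vcons a v \o vcons ord0 (fun i => lift ord0 (f i)) =
             vcons a (v \o f).
    rewrite vcons_comp vcons0; congr vcons.
    by apply: funext => i /=; rewrite vconsS.
  by split=> H a; have := H a; rewrite IH E.
Qed.

Lemma automorphism_sat (L : language) (M : structure L) (s : M -> M)
    (n : nat) (phi : formula L n) (v : 'I_n -> M) :
  automorphism s -> (sat phi v <-> sat phi (s \o v)).
Proof.
move=> [[r sK rK] sF sR].
have sE m (t : term L m) w : s (eval w t) = eval (s \o w) t.
  elim: t => //= g args IH; rewrite sF; congr func_interp.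
  by apply: funext => j; exact: IH.
elim: phi v => {n} [n|n t1 t2|n q args|n phi1 IH1 phi2 IH2|n phi IH] v //=.
- by rewrite -!sE; split=> [->|/(can_inj sK)].
- rewrite sR; suff -> : (fun j => eval (s \o v) (args j)) =
    s \o (fun j => eval v (args j)) by [].
  by apply: funext => j /=; rewrite sE.
- by rewrite IH1 IH2.
(* Surjectivity of [s] is what handles the quantifier: every [a] is the image of [r a]. *)
- split=> H a; first by have := H (r a); rewrite IH vcons_comp rK.
  by rewrite IH vcons_comp.
Qed.

(** * Small sets, types and closure in a monster model *)

(** Even over an empty language, [Bot] gives a formula in each number of variables. *)
Lemma infinite_formulas (L : language) :
  infinite_set [set: {n : nat & formula L n}].
Proof.
move=> /(finite_image (@tag _ _)) fin; apply: infinite_nat.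
apply: sub_finite_set fin => n _.
by exists (existT (fun m => formula L m) n (Bot L n)).
Qed.

(** [kappa] is infinite because it dominates the infinite set of formulas. *)
Lemma finite_small (L : language) (kappa : Type) (T : theory L)
    (M : structure L) (A : set M) :
  monster_model kappa T M -> finite_set A -> small kappa A.
Proof.
move=> [_ [ck _] _ _ _] finA.
have inf_kappa : infinite_set [set: kappa].
  by move/(card_le_finite ck); exact: infinite_formulas.
split; last by move/card_le_finite => /(_ finA).
apply: card_le_trans (finite_set_countable finA) _.
exact/infiniteP.
Qed.

(* [b0] only fills the parameter slots of the coordinates equal to [a]. *)
Lemma same_type_elementary (L : language) (M : structure L) (B : set M)
    (a a' b0 : M) :
  B b0 -> same_type B a a' ->
  elementary_on (B `|` [set a]) (fun x => if `[< x = a >] then a' else x).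
Proof.
move=> Bb0 aa' n phi v vB.
(* All coordinates equal to [a] are merged into the object variable; the others, which lie in [B],
   become parameters. *)
pose g (i : 'I_n) : 'I_n.+1 := if `[< v i = a >] then ord0 else lift ord0 i.
pose w (i : 'I_n) : M := if `[< v i = a >] then b0 else v i.
have wB i : B (w i).
  by rewrite /w; case: asboolP => // va; case: (vB i) => // /va.
have := aa' (ParamFormula (rename phi g) w) wB.
rewrite /realizes /= !sat_rename.
have E c : vcons c w \o g = fun i => if `[< v i = a >] then c else v i.
  apply: funext => i /=; rewrite /g; case: asboolP => va; first by rewrite vcons0.
  by rewrite vconsS /w; case: asboolP.
rewrite !E; have -> // : (fun i => if `[< v i = a >] then a else v i) = v.
by apply: funext => i; case: asboolP.
Qed.

(** This replaces the inclusion of dcl in [cl]. If [a] were outside [cl B], Existence with $C =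
    \{a\}$ would give a conjugate [a'] of [a] over [B] outside $\mathrm{cl}(B \cup \{a\})$, and
    homogeneity an automorphism over [B] sending [a] to [a']; fixing [a] then forces $a' = a$. *)
Lemma fixed_in_cl (L : language) (kappa : Type) (T : theory L)
    (M : structure L) (cl : set M -> set M) (B : set M) (b0 a : M) :
  monster_model kappa T M -> existential_matroid kappa cl ->
  finite_set B -> B b0 ->
  (forall s : M -> M, automorphism s -> (forall b, B b -> s b = b) -> s a = a) ->
  cl B a.
Proof.
move=> monM [matcl _ excl _] finB Bb0 fixa; apply: contrapT => ncl.
have sm (A : set M) : finite_set A -> small kappa A by exact: finite_small monM.
have [a' [aa' ncla']] := excl a B [set a] (sm _ finB) (sm _ (finite_set1 a)) ncl.
have [|s [auts sE]] := monster_homogeneous monM _ (same_type_elementary Bb0 aa').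
  by apply: sm; rewrite finite_setU.
have sa : s a = a' by rewrite sE; [rewrite asboolT | right].
apply: ncla'; apply: (cl_ext matcl); right; rewrite /= -sa fixa // => b Bb.
rewrite sE; last by left.
(* The map is the identity on [B], since [a] itself is not in [B]. *)
case: asboolP => // ba; exfalso; apply: ncl; apply: (cl_ext matcl).
by rewrite -ba.
Qed.

(** By monotonicity, nontriviality already yields an element outside [cl set0]; Existence then moves
    it away from [C]. *)
Lemma generic_element (L : language) (kappa : Type) (T : theory L)
    (M : structure L) (cl : set M -> set M) (C : set M) :
  monster_model kappa T M -> existential_matroid kappa cl -> finite_set C ->
  exists a, ~ cl C a.
Proof.
move=> monM [matcl _ excl ntcl] finC.
have sm (A : set M) : finite_set A -> small kappa A by exact: finite_small monM.
have [a ncla] : exists a, ~ cl set0 a.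
  apply: contrapT => /forallNP cl0; apply: ntcl; apply: funext => A.
  apply/seteqP; split=> // x _; apply: (cl_mono matcl (@sub0set _ A)).
  by apply: contrapT; exact: cl0.
have [a' [_ a'P]] := excl a set0 C (sm _ (finite_set0 _)) (sm _ finC) ncla.
by exists a'; rewrite set0U in a'P.
Qed.

(** * Perfectness of a field with an existential matroid *)

Lemma automorphism_field (L : language) (M : structure L) (F : fieldType)
    (iota : F -> M) (s : M -> M) :
  expands_field iota -> automorphism s ->
  exists t : {rmorphism F -> F}, forall x, iota (t x) = s (iota x).
Proof.
case=> -[r iK rK] [phiA phiAE] [phiM phiME] auts.
pose t x := r (s (iota x)).
have tE x : iota (t x) = s (iota x) by rewrite /t rK.
have E x y z : s \o vcons (iota x) (vcons (iota y) (vcons (iota z) (@vnil M)))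
   = vcons (iota (t x)) (vcons (iota (t y)) (vcons (iota (t z)) (@vnil M))).
  by rewrite !vcons_comp comp_vnil !tE.
have tD x y : t (x + y) = t x + t y.
  by apply/esym/phiAE; rewrite -E -automorphism_sat // phiAE.
have tM x y : t (x * y) = t x * t y.
  by apply/esym/phiME; rewrite -E -automorphism_sat // phiME.
have t0 : t 0 = 0 by apply: (addrI (t 0)); rewrite -tD !addr0.
have tB : zmod_morphism t.
  by move=> x y; apply: (addIr (t y)); rewrite -tD !subrK.
have tI : injective t.
  case: auts => -[r' sK _] _ _ x y txy; apply: (can_inj iK).
  by apply: (can_inj sK); rewrite -!tE txy.
(* $t(1)$ is idempotent and, by injectivity, nonzero. *)
have t1 : t 1 = 1.
  have nz : t 1 != 0 by rewrite -t0 (inj_eq tI) oner_eq0.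
  by apply: (mulfI nz); rewrite -tM !mulr1.
pose tA := GRing.isZmodMorphism.Build F F t tB.
pose tMl := GRing.isMonoidMorphism.Build F F t (conj t1 tM).
pose tR : {rmorphism F -> F} := HB.pack t tA tMl.
by exists tR.
Qed.

(** Frobenius is additive, so the equation reads $c (y' - y)^p = (x - x')^p$; if $y' \ne y$,
    dividing would give a $p$-th root of $c$. *)
Lemma pchar_exprD_inj (F : fieldType) (p : nat) (c x y x' y' : F) :
  p \in [pchar F] -> (forall d, d ^+ p != c) ->
  x ^+ p + c * y ^+ p = x' ^+ p + c * y' ^+ p -> x = x' /\ y = y'.
Proof.
move=> pF nc E.
have pB (u v : F) : (u - v) ^+ p = u ^+ p - v ^+ p.
  exact: (rmorphB (pFrobenius_aut pF)).
have p_gt0 : (0 < p)%N by rewrite prime_gt0 ?(pcharf_prime pF).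
have E' : c * (y' - y) ^+ p = (x - x') ^+ p.
  rewrite !pB mulrBr; apply/eqP; rewrite subr_eq addrAC eq_sym subr_eq.
  by rewrite [X in _ == X]addrC -E.
have yy : y' - y = 0.
  apply/eqP/negPn/negP => nz; have /eqP := nc ((x - x') / (y' - y)); apply.
  by rewrite expr_div_n -E' mulfK // expf_neq0.
move/eqP: E'; rewrite yy expr0n eqn0Ngt p_gt0 mulr0 eq_sym expf_eq0 p_gt0 /=.
by rewrite subr_eq0 => /eqP ->; split=> //; apply/esym/eqP; rewrite -subr_eq0 yy.
Qed.

Lemma existential_matroid_perfect (L : language) (kappa : Type) (T : theory L)
    (M : structure L) (cl : set M -> set M) (F : fieldType) (iota : F -> M) :
  monster_model kappa T M -> existential_matroid kappa cl ->
  expands_field iota -> perfect_field F.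
Proof.
move=> monM excl expF p pF c; apply: contrapT => /forallNP nc.
have matcl := existential_is_matroid excl.
have [r iK rK] := expands_bijective expF.
have [a ncla] := generic_element monM excl (finite_set1 (iota c)).
have [b nclb] : exists b, ~ cl ([set iota c] `|` [set a]) b.
  by apply: generic_element monM excl _; rewrite finite_setU.
pose z := iota (r a ^+ p + c * r b ^+ p).
have fixab s : automorphism s ->
    (forall e, ([set iota c] `|` [set z]) e -> s e = e) -> s a = a /\ s b = b.
  move=> auts sfix; have [t tE] := automorphism_field expF auts.
  have tc : t c = c by apply: (can_inj iK); rewrite tE sfix //; left.
  have tz : t (r a ^+ p + c * r b ^+ p) = r a ^+ p + c * r b ^+ p.
    by apply: (can_inj iK); rewrite tE sfix //; right.
  move: tz; rewrite rmorphD rmorphM !rmorphXn tc => tz.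
  have [|ta tb] := pchar_exprD_inj pF _ tz; first by move=> d; apply/eqP/nc.
  by rewrite -[a]rK -[b]rK -!tE ta tb.
have incl e : (forall s, automorphism s ->
    (forall d, ([set iota c] `|` [set z]) d -> s d = d) -> s e = e) ->
    cl ([set iota c] `|` [set z]) e.
  by apply: fixed_in_cl monM excl _ _; [rewrite finite_setU | left].
have cla : cl ([set iota c] `|` [set z]) a by apply: incl => s ? /fixab[].
have clb : cl ([set iota c] `|` [set z]) b by apply: incl => s ? /fixab[].
have clz := cl_exchange matcl cla ncla.
(* Both [iota c] and [z] lie in the closure of [iota c] and [a], so idempotence puts [b] there
   too. *)
apply: nclb; rewrite -(cl_idem matcl); apply: (cl_mono matcl _ clb).
by move=> e [->|->] //; apply: (cl_ext matcl); left.
Qed.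

(** * Perfect separably closed fields *)

(** A zero derivative leaves only exponents divisible by $p$, so $f = h(X^p)$; taking $p$-th roots
    of the coefficients of $h$ gives $g$. *)
Lemma perfect_deriv0_pth_power (F : fieldType) (p : nat) (f : {poly F}) :
  p \in [pchar F] -> perfect_field F -> (1 < size f)%N -> f^`() = 0 ->
  exists2 g : {poly F}, (1 < size g < size f)%N &
    forall x, f.[x] = g.[x] ^+ p.
Proof.
move=> pF perf f_gt1 f'0; have p_pr := pcharf_prime pF.
have p_gt0 := prime_gt0 p_pr.
have coef_f i : ~~ (p %| i)%N -> f`_i = 0.
  case: i => [|i]; first by rewrite dvdn0.
  rewrite (dvdn_pcharf pF) => nz; move/polyP/(_ i)/eqP: f'0.
  by rewrite coef_deriv coef0 -mulr_natr mulf_eq0 (negPf nz) orbF => /eqP.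
have [r rP] := choice (perf p pF).
pose m := ((size f).-1 %/ p).+1.
pose h := \poly_(i < m) f`_(i * p); pose g := \poly_(i < m) r f`_(i * p).
have fh : f = h \Po 'X^p.
  apply/polyP => i; rewrite coef_comp_poly_Xn //.
  case: ifP => [/dvdnP[k ->]|/negbT/coef_f //].
  rewrite mulnK // coef_poly ltnS; case: leqP => //.
  (* Past the range of [h], the exponent [k * p] exceeds the degree of [f]. *)
  rewrite ltn_divLR // => lt_f; apply: nth_default.
  by case: (size f) lt_f f_gt1 => [|n].
have gE x : f.[x] = g.[x] ^+ p.
  have Fr := rmorph_sum (pFrobenius_aut pF).
  rewrite fh horner_comp hornerXn !horner_poly -[RHS]/(pFrobenius_aut pF _) Fr.
  apply: eq_bigr => i _; rewrite rmorphM rmorphXn /= !pFrobenius_autE rP.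
  by rewrite -!exprM mulnC.
have p_dvd : (p %| (size f).-1)%N.
  apply: contraTT f_gt1 => /coef_f; rewrite -lead_coefE => /eqP.
  by rewrite lead_coef_eq0 => /eqP ->; rewrite size_poly0.
have f_gt0 : (0 < (size f).-1)%N by case: (size f) f_gt1 => [|[]].
exists g => //; apply/andP; split; last first.
  apply: leq_ltn_trans (size_poly _ _) _; rewrite /m.
  have : ((size f).-1 %/ p < (size f).-1)%N by rewrite ltn_Pdiv ?prime_gt1.
  by case: (size f) f_gt1 => //.
apply: leq_trans (_ : ((size f).-1 %/ p).+1 <= _)%N.
  by rewrite ltnS divn_gt0 // dvdn_leq.
(* As [p] divides the degree of [f], the top coefficient of [g] is a [p]-th root of the leading
   coefficient of [f], hence nonzero. *)
rewrite size_poly_eq // divnK // -lead_coefE.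
have : lead_coef f != 0 by rewrite lead_coef_eq0 -size_poly_gt0 ltnW.
by rewrite -{1}[lead_coef f]rP expf_eq0 p_gt0.
Qed.

(** Strong induction on the size of $f$. If $f' = 0$, a root of the shorter $g$ with $f(x) = g(x)^p$
    is a root of $f$; otherwise $f / \gcd(f, f')$ is separable and nonconstant, and its roots are
    roots of $f$. *)
Lemma separably_closed_perfect (F : fieldType) :
  separably_closed F -> perfect_field F -> algebraically_closed F.
Proof.
move=> scF perf f; have [n] := ubnP (size f).
elim: n f => // n IH f; rewrite ltnS => fn f_gt1.
have nz_f : f != 0 by rewrite -size_poly_gt0 ltnW.
have [f'0|nz_f'] := eqVneq f^`() 0.
  have [p pF] : exists p, p \in [pchar F].
    apply: (@natf0_pchar _ (size f).-1); first by case: (size f) f_gt1 => [|[]].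
    (* The top coefficient of $f'$ is the leading coefficient of $f$ times its degree, so the degree
       vanishes in [F]. *)
    move/polyP/(_ (size f).-2)/eqP: f'0; rewrite coef_deriv coef0.
    have -> : (size f).-2.+1 = (size f).-1 by case: (size f) f_gt1 => [|[]].
    rewrite -lead_coefE -[lead_coef f *+ _]mulr_natr mulf_eq0 lead_coef_eq0.
    by rewrite (negPf nz_f).
  have [g /andP[g_gt1 gf] gE] := perfect_deriv0_pth_power pF perf f_gt1 f'0.
  have [x /rootP gx] := IH g (leq_trans gf fn) g_gt1.
  exists x; apply/rootP; rewrite gE gx expr0n.
  by rewrite eqn0Ngt prime_gt0 // (pcharf_prime pF).
pose q := f %/ gcdp f f^`().
have q_gt1 : (1 < size q)%N.
  have nz_g : gcdp f f^`() != 0 by rewrite gcdp_eq0 (negPf nz_f).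
  (* The gcd is no longer than $f'$, which is shorter than $f$, so the quotient is not constant. *)
  have := leq_ltn_trans (leq_gcdpr f nz_f') (lt_size_deriv nz_f).
  rewrite size_divp //; move: nz_g; rewrite -size_poly_gt0.
  case: (size (gcdp _ _)) => // k _ lt_k; rewrite ltn_subRL /=.
  by rewrite addn1.
have [x qx] := scF q q_gt1 (make_separable nz_f).
by exists x; rewrite -(divpK (dvdp_gcdl f f^`())) rootM qx.
Qed.

(** * The characteristic of a field *)

Lemma has_characteristic_eq (F : fieldType) (p q : nat) :
  has_characteristic F p -> q \in [pchar F] -> q = p.
Proof.
move=> charF qF.
have /charF /(primeP (pcharf_prime qF)).2 /orP[/eqP p1|/eqP//] := pcharf0 qF.
have /(charF 1).2/eqP : (p %| 1)%N by rewrite p1.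
by rewrite mulr1n oner_eq0.
Qed.

(* In particular [imperfect_theory p] is inconsistent unless [p] is prime. *)
Lemma has_characteristic_nonprime (F : fieldType) (p : nat) :
  has_characteristic F p -> ~~ prime p -> perfect_field F.
Proof.
move=> charF npr q qF; case/negP: npr.
by rewrite -(has_characteristic_eq charF qF) (pcharf_prime qF).
Qed.

Lemma has_characteristic_pchar (F : fieldType) (p : nat) :
  has_characteristic F p -> prime p -> p \in [pchar F].
Proof. by move=> charF p_pr; rewrite inE p_pr; apply/eqP/charF. Qed.

(** * Derivations and differentially closed fields *)

(* [F] is the fraction field of [R]. *)
Lemma extend_derivation (R : comNzRingType) (F : fieldType)
    (h : {rmorphism R -> F}) (D : R -> R) :
  injective h ->
  (forall x : F, exists ab : R * R, h ab.2 != 0 /\ x * h ab.2 = h ab.1) ->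
  {morph D : x y / x + y} -> (forall x y, D (x * y) = D x * y + x * D y) ->
  exists d : F -> F, derivation d /\ forall x, d (h x) = h (D x).
Proof.
move=> h_inj quoF DD DM; have [nd ndP] := choice quoF.
(* The quotient rule in the form $d(n/m) = (Dn - (n/m) Dm)/m$, for a chosen representation of each
   [x]. *)
pose d x := (h (D (nd x).1) - x * h (D (nd x).2)) / h (nd x).2.
have dE x a b : h b != 0 -> x * h b = h a -> d x = (h (D a) - x * h (D b)) / h b.
  move=> b0 xb; have [] := ndP x; rewrite /d; move: (nd x).1 (nd x).2.
  move=> n m m0 xm.
  (* Independence of the representation comes from differentiating the cross-multiplied identity. *)
  have E : D (a * m) = D (n * b).
    by congr D; apply: h_inj; rewrite !rmorphM -xb -xm mulrAC.
  move/(congr1 h): E; rewrite !DM !rmorphD !rmorphM -xb -xm => E.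
  apply/esym/eqP; rewrite eqr_div //; apply/eqP.
  transitivity (h (D a) * h m + x * h b * h (D m)
    - x * h b * h (D m) - x * h (D b) * h m); first by ring.
  by rewrite E; ring.
have D1 : D 1 = 0.
  by apply: (addIr (D 1)); rewrite add0r -{3}[1]mulr1 DM mul1r mulr1.
exists d; split; last first.
  move=> x; rewrite (dE _ x 1) ?rmorph1 ?oner_neq0 ?mulr1 //.
  by rewrite D1 rmorph0 mulr0 subr0 divr1.
split=> x y; have [[a b] /= [b0 xb]] := quoF x;
  have [[c e] /= [e0 ye]] := quoF y; rewrite (dE x a b) // (dE y c e) //.
  rewrite (dE (x + y) (a * e + c * b) (b * e)) ?rmorphM ?mulf_neq0 //; last first.
    by rewrite rmorphD !rmorphM -xb -ye; ring.
  by rewrite DD !DM !rmorphD !rmorphM -xb -ye; field; rewrite b0 e0.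
rewrite (dE (x * y) (a * c) (b * e)) ?rmorphM ?mulf_neq0 //; last first.
  by rewrite -xb -ye; ring.
by rewrite !DM !rmorphD !rmorphM -xb -ye; field; rewrite b0 e0.
Qed.

(** The pair is read off a representative of [x]; multiplication descends to the quotient, where
    equality is cross-multiplication. *)
Lemma fraction_quotient (R : idomainType) (x : {fraction R}) :
  exists ab : R * R, tofrac ab.2 != 0 /\ x * tofrac ab.2 = tofrac ab.1.
Proof.
exists (frac (repr x)); split; first by rewrite tofrac_eq0 denom_ratioP.
move: (reprK x); set y := repr x => <-; unlock FracField.tofrac.
rewrite -[LHS]FracField.pi_mul; apply/eqmodP => /=.
rewrite FracField.equivfE /FracField.mulf !numden_Ratio ?mulf_neq0 ?oner_neq0
  ?denom_ratioP //.
by rewrite !mulr1 mulrC.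
Qed.

Lemma differentially_closed_neq0 (K : fieldType) (d : K -> K) :
  differentially_closed d -> exists x, d x != 0.
Proof.
move=> [_ dcK]; apply: contrapT => /forallNP d0.
have {}d0 x : d x = 0 by apply: contrapT => /eqP; exact: d0.
have frac_inj : injective (@tofrac {poly K}).
  by move=> x y /eqP; rewrite tofrac_eq => /eqP.
have [dF [dFd dFE]] := extend_derivation frac_inj (@fraction_quotient _)
  (@derivD K) (@derivM K).
pose h : {rmorphism K -> {fraction {poly K}}} := @tofrac {poly K} \o polyC.
(* Constants have zero derivative in $K(X)$, so the assumption $d = 0$ makes $K(X)$ a differential
   extension of $K$. *)
have hd x : h (d x) = dF (h x) by rewrite d0 rmorph0 /= dFE derivC rmorph0.
(* If [d] were zero, the system dx <> 0 would be solvable in K(X) with d/dX. *)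
pose x0 : term diff_language (1 + 0) := Var _ ord0.
pose dx0 : term diff_language (1 + 0) := @App diff_language _ None (fun=> x0).
pose z0 : term diff_language (1 + 0) :=
  @App diff_language _ (Some RZero) (fun i => match notF (ltn_ord i) with end).
have [//||a /=] := dcK _ dF h dFd hd 1 0 (Not (Eq dx0 z0)) (@vnil _).
  exists (fun=> tofrac 'X) => /=; rewrite /vcat /=.
  case: fintype.split => [_|[]//] /eqP.
  by rewrite dFE derivX tofrac_eq0 oner_eq0.
by rewrite d0.
Qed.

(** $d(y^p) = p y^{p-1} dy = 0$, so an element with nonzero derivative has no $p$-th root. *)
Lemma differentially_closed_imperfect (K : fieldType) (d : K -> K) (p : nat) :
  p \in [pchar K] -> differentially_closed d -> ~ perfect_field K.
Proof.
move=> pK dcd perf; have [x dx] := differentially_closed_neq0 dcd.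
have [[dD dM] _] := dcd; have [y yx] := perf p pK x.
have dX n : d (y ^+ n.+1) = (y ^+ n * d y) *+ n.+1.
  elim: n => [|n IH]; first by rewrite !expr1 expr0 mul1r.
  rewrite exprS dM IH [in RHS]mulrS [in RHS]exprS.
  by rewrite [d y * _]mulrC exprS mulrnAr mulrA.
move: dx; rewrite -yx -(prednK (prime_gt0 (pcharf_prime pK))) dX.
by rewrite prednK ?mulrn_pchar ?eqxx // prime_gt0 // (pcharf_prime pK).
Qed.

(** * Ring terms and their values *)

Definition tzero (n : nat) : term ring_language n :=
  @App ring_language n RZero (@vnil _).

Definition tone (n : nat) : term ring_language n :=
  @App ring_language n ROne (@vnil _).

Definition topp (n : nat) (t : term ring_language n) : term ring_language n :=
  @App ring_language n ROpp (vcons t (@vnil _)).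

Definition tadd (n : nat) (t u : term ring_language n) : term ring_language n :=
  @App ring_language n RAdd (vcons t (vcons u (@vnil _))).

Definition tmul (n : nat) (t u : term ring_language n) : term ring_language n :=
  @App ring_language n RMul (vcons t (vcons u (@vnil _))).

Definition var0 (L : language) (n : nat) : term L n.+1 := Var L ord0.

Definition var1 (L : language) (n : nat) : term L n.+2 := Var L (lift ord0 ord0).

Definition var2 (L : language) (n : nat) : term L n.+3 :=
  Var L (lift ord0 (lift ord0 ord0)).

Arguments tzero {n}.
Arguments tone {n}.
Arguments var0 {L n}.
Arguments var1 {L n}.
Arguments var2 {L n}.

Section RingStructure.
Variable N : structure ring_language.

Definition szero : N := @func_interp _ N RZero (@vnil N).
Definition sone : N := @func_interp _ N ROne (@vnil N).
Definition sopp (a : N) : N := @func_interp _ N ROpp (vcons a (@vnil N)).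
Definition sadd (a b : N) : N :=
  @func_interp _ N RAdd (vcons a (vcons b (@vnil N))).
Definition smul (a b : N) : N :=
  @func_interp _ N RMul (vcons a (vcons b (@vnil N))).

Lemma eval_tzero (n : nat) (v : 'I_n -> N) : eval v tzero = szero.
Proof. by rewrite /szero -(comp_vnil (eval v)). Qed.

Lemma eval_tone (n : nat) (v : 'I_n -> N) : eval v tone = sone.
Proof. by rewrite /sone -(comp_vnil (eval v)). Qed.

Lemma eval_topp (n : nat) (v : 'I_n -> N) t : eval v (topp t) = sopp (eval v t).
Proof. by rewrite /sopp -(comp_vnil (eval v)) -vcons_comp. Qed.

Lemma eval_tadd (n : nat) (v : 'I_n -> N) t u :
  eval v (tadd t u) = sadd (eval v t) (eval v u).
Proof. by rewrite /sadd -(comp_vnil (eval v)) -!vcons_comp. Qed.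

Lemma eval_tmul (n : nat) (v : 'I_n -> N) t u :
  eval v (tmul t u) = smul (eval v t) (eval v u).
Proof. by rewrite /smul -(comp_vnil (eval v)) -!vcons_comp. Qed.

Lemma eval_var0 (n : nat) (v : 'I_n -> N) a : eval (vcons a v) var0 = a.
Proof. by rewrite /= vcons0. Qed.

Lemma eval_var1 (n : nat) (v : 'I_n -> N) a b :
  eval (vcons a (vcons b v)) var1 = b.
Proof. by rewrite /= vconsS vcons0. Qed.

Lemma eval_var2 (n : nat) (v : 'I_n -> N) a b c :
  eval (vcons a (vcons b (vcons c v))) var2 = c.
Proof. by rewrite /= !vconsS vcons0. Qed.

Definition evalE := (eval_tzero, eval_tone, eval_topp, eval_tadd, eval_tmul,
  eval_var0, eval_var1, eval_var2).

End RingStructure.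

(* Keeps [/=] from unfolding ring terms into raw function applications. *)
#[local] Opaque tzero tone topp tadd tmul var0 var1 var2.

Lemma field_structureE (F : fieldType) :
  ((szero (field_structure F) = 0%R :> F) *
   (sone (field_structure F) = 1%R :> F) *
   (forall x : F, @sopp (field_structure F) x = (- x)%R) *
   (forall x y : F, @sadd (field_structure F) x y = (x + y)%R) *
   (forall x y : F, @smul (field_structure F) x y = (x * y)%R))%type.
Proof.
(* [ring_interp] reads the second argument at [ord_max], while [vcons] stores it at
   [lift ord0 ord0]. *)
have om : ord_max = lift ord0 ord0 :> 'I_2 by apply: val_inj.
by do !split=> *; rewrite /szero /sone /sopp /sadd /smul /= ?om ?vconsS ?vcons0.
Qed.

(** * First-order axioms of imperfect fields *)

(** The ring language has no symbol for the inverse, so inverses are only assumed to exist and are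
    picked by choice. *)
Lemma field_of_axioms (T : Type) (zero one : T) (opp : T -> T)
    (add mul : T -> T -> T) :
  associative add -> commutative add -> left_id zero add ->
  left_inverse zero opp add ->
  associative mul -> commutative mul -> left_id one mul ->
  left_distributive mul add -> one <> zero ->
  (forall x, exists y, x <> zero -> mul y x = one) ->
  exists (F : fieldType) (iota : F -> T),
    [/\ bijective iota, iota 0 = zero, iota 1 = one,
        forall x y, iota (x + y) = add (iota x) (iota y) &
        forall x y, iota (x * y) = mul (iota x) (iota y)].
Proof.
move=> addA addC add0 addN mulA mulC mul1 mulDl one_neq0 ex_inv.
have [inv invP] := choice ex_inv.
(* The field structure requires the inverse of zero to be zero, which the chosen [inv] need not
   satisfy. *)
pose inv0 x := if `[< x = zero >] then zero else inv x.
(* [{classic T}] equips the bare type [T] with decidable equality and choice. *)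
pose fZ := GRing.isZmodule.Build {classic T} addA addC add0 addN.
pose Z : zmodType := HB.pack {classic T} fZ.
have one_neq0b : (one : Z) != 0 by apply/eqP.
pose fR := GRing.Zmodule_isComNzRing.Build Z mulA mulC mul1 mulDl one_neq0b.
pose R : comNzRingType := HB.pack Z fR.
have mulVx (x : R) : x != 0 -> (inv0 x : R) * x = 1.
  by move=> /eqP x0; rewrite /inv0; case: asboolP => // _; exact: invP.
have inv00 : (inv0 (0 : R) : R) = 0 by rewrite /inv0 asboolT.
pose fF := GRing.ComNzRing_isField.Build R mulVx inv00.
pose F : fieldType := HB.pack R fF.
by exists F, (fun x => x); split=> //; exists (fun x => x).
Qed.

(** Equating this numeral with [tzero], for $k = p$, expresses characteristic $p$ by a sentence. *)
Lemma eval_numeral (F : fieldType) (N : structure ring_language)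
    (iota : F -> N) (n : nat) (v : 'I_n -> N) (k : nat) :
  iota 0 = szero N -> iota 1 = sone N ->
  (forall x y, iota (x + y) = sadd (iota x) (iota y)) ->
  eval v (iter k (tadd tone) tzero) = iota k%:R.
Proof.
move=> iota0 iota1 iotaD; elim: k => [|k IH]; first by rewrite evalE.
by rewrite /= !evalE IH -iota1 -iotaD -mulrS.
Qed.

Lemma eval_power (F : fieldType) (N : structure ring_language)
    (iota : F -> N) (n : nat) (v : 'I_n -> N) (k : nat) (y : F) :
  iota 1 = sone N ->
  (forall x y, iota (x * y) = smul (iota x) (iota y)) ->
  eval (vcons (iota y) v) (iter k (tmul var0) tone) = iota (y ^+ k).
Proof.
move=> iota1 iotaM; elim: k => [|k IH]; first by rewrite evalE.
by rewrite /= !evalE IH -iotaM -exprS.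
Qed.

(** The common core of the two negative results: [SCF_nonACF p] contains it, and for prime [p] so
    does [DCF p] after translation. *)
Definition imperfect_theory (p : nat) : theory ring_language :=
  [set s | forall F : fieldType, has_characteristic F p -> ~ perfect_field F ->
     holds (field_structure F) s].

(** The theory contains the field axioms and, for prime [p], the sentences saying that $p = 0$ and
    that some element has no $p$-th root. *)
Lemma imperfect_theory_field (p : nat) (N : structure ring_language) :
  model (imperfect_theory p) N ->
  exists (F : fieldType) (iota : F -> N),
    [/\ bijective iota, forall x y, iota (x + y) = sadd (iota x) (iota y),
        forall x y, iota (x * y) = smul (iota x) (iota y) & ~ perfect_field F].
Proof.
move=> modN.
have valid s : (forall F : fieldType, holds (field_structure F) s) -> holds N s.
  by move=> Fs; apply: modN => F _ _; exact: Fs.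
have addA : associative (@sadd N).
  (* The outermost quantifier binds the variable of highest index, hence the instantiation in the
     order [z y x]. *)
  move=> x y z; suff /valid/(_ z y x) : forall F : fieldType,
    holds (field_structure F) (All (All (All
      (Eq (tadd var0 (tadd var1 var2)) (tadd (tadd var0 var1) var2))))).
    by rewrite /= !evalE.
  by move=> F c b a /=; rewrite !evalE !field_structureE addrA.
have addC : commutative (@sadd N).
  move=> x y; suff /valid/(_ y x) : forall F : fieldType,
    holds (field_structure F) (All (All
      (Eq (tadd var0 var1) (tadd var1 var0)))).
    by rewrite /= !evalE.
  by move=> F b a /=; rewrite !evalE !field_structureE addrC.
have add0 : left_id (szero N) (@sadd N).
  move=> x; suff /valid/(_ x) : forall F : fieldType,
    holds (field_structure F) (All (Eq (tadd tzero var0) var0)).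
    by rewrite /= !evalE.
  by move=> F a /=; rewrite !evalE !field_structureE add0r.
have addN : left_inverse (szero N) (@sopp N) (@sadd N).
  move=> x; suff /valid/(_ x) : forall F : fieldType,
    holds (field_structure F) (All (Eq (tadd (topp var0) var0) tzero)).
    by rewrite /= !evalE.
  by move=> F a /=; rewrite !evalE !field_structureE addNr.
have mulA : associative (@smul N).
  move=> x y z; suff /valid/(_ z y x) : forall F : fieldType,
    holds (field_structure F) (All (All (All
      (Eq (tmul var0 (tmul var1 var2)) (tmul (tmul var0 var1) var2))))).
    by rewrite /= !evalE.
  by move=> F c b a /=; rewrite !evalE !field_structureE mulrA.
have mulC : commutative (@smul N).
  move=> x y; suff /valid/(_ y x) : forall F : fieldType,
    holds (field_structure F) (All (All
      (Eq (tmul var0 var1) (tmul var1 var0)))).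
    by rewrite /= !evalE.
  by move=> F b a /=; rewrite !evalE !field_structureE mulrC.
have mul1 : left_id (sone N) (@smul N).
  move=> x; suff /valid/(_ x) : forall F : fieldType,
    holds (field_structure F) (All (Eq (tmul tone var0) var0)).
    by rewrite /= !evalE.
  by move=> F a /=; rewrite !evalE !field_structureE mul1r.
have mulDl : left_distributive (@smul N) (@sadd N).
  move=> x y z; suff /valid/(_ z y x) : forall F : fieldType,
    holds (field_structure F) (All (All (All (Eq
      (tmul (tadd var0 var1) var2) (tadd (tmul var0 var2) (tmul var1 var2)))))).
    by rewrite /= !evalE.
  by move=> F c b a /=; rewrite !evalE !field_structureE mulrDl.
have one_neq0 : sone N <> szero N.
  suff /valid : forall F : fieldType,
    holds (field_structure F) (Not (Eq tone tzero)).
    by rewrite /holds /= !evalE.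
  move=> F; rewrite /holds /= !evalE !field_structureE => /eqP.
  by rewrite oner_eq0.
have ex_inv (x : N) : exists y, x <> szero N -> smul y x = sone N.
  apply: contrapT => /forallNP ninv.
  (* Existence is written with [Not] and [All]; the element to invert is [var0] in the premise but
     [var1] under the inner quantifier. *)
  suff /valid/(_ x) : forall F : fieldType, holds (field_structure F)
    (All (Imp (Not (Eq var0 tzero)) (Not (All (Not (Eq (tmul var0 var1) tone)))))).
    rewrite /= !evalE; apply=> [x0|y]; first by apply: (ninv x).
    by rewrite !evalE => yx; apply: (ninv y).
  move=> F a /=; rewrite !evalE field_structureE => /eqP a0 /(_ (a^-1 : F)).
  by rewrite !evalE !field_structureE mulVf // => /(_ erefl).
have [F [iota [bij_iota iota0 iota1 iotaD iotaM]]] :=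
  field_of_axioms addA addC add0 addN mulA mulC mul1 mulDl one_neq0 ex_inv.
(* If [p] is not prime, no field of characteristic [p] is imperfect, so [Bot] belongs to the theory
   and [N] cannot exist. *)
exists F, iota; split=> // perfF; have [p_pr|np] := boolP (prime p); last first.
  by apply: (modN (Bot _ _)) => F' cF' []; exact: has_characteristic_nonprime np.
have [r iK rK] := bij_iota.
have pF : p \in [pchar F].
  rewrite inE p_pr; apply/eqP/(can_inj iK).
  suff /modN : imperfect_theory p (Eq (iter p (tadd tone) tzero) tzero).
    by rewrite /holds /= (@eval_numeral _ _ iota) // evalE -iota0.
  move=> F' cF' _; rewrite /holds /=.
  have fE := field_structureE F'.
  rewrite (@eval_numeral F' (field_structure F') id) ?evalE ?fE //; first exact/cF'.
  by move=> *; rewrite fE.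
(* The sentence says that some element has no [p]-th root; [var1] is that element and [var0] the
   candidate root. *)
suff /modN : imperfect_theory p
  (Not (All (Not (All (Not (Eq (iter p (tmul var0) tone) var1)))))).
  rewrite /holds /=; apply=> x ny; have [z zp] := perfF p pF (r x).
  by apply: (ny (iota z)); rewrite eval_power // zp rK eval_var1.
move=> F' cF' imperfF' H; apply: imperfF' => q qF' x.
apply: contrapT => nx; apply: (H x) => y.
have fE := field_structureE F'.
have /= -> := @eval_power F' (field_structure F') id 1 (vcons x (@vnil F')) p y;
  [|by []|by move=> a b; exact: esym (fE.2 a b)].
rewrite eval_var1 -(has_characteristic_eq cF' qF') => yx.
by apply: nx; exists y.
Qed.

(** * Reducts to the ring language *)

(** Abstracting the translation of formulas covers both languages: it is the identity for rings and
    [diff_formula] for differential rings. *)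
Lemma ring_reduct_expands (L : language) (M : structure L)
    (N : structure ring_language) (F : fieldType) (iota : F -> N)
    (lift_formula : forall n, formula ring_language n -> formula L n)
    (j : N -> M) :
  bijective j ->
  (forall n (phi : formula ring_language n) v,
     sat (lift_formula n phi) (j \o v) <-> sat phi v) ->
  bijective iota -> (forall x y, iota (x + y) = sadd (iota x) (iota y)) ->
  (forall x y, iota (x * y) = smul (iota x) (iota y)) ->
  expands_field (j \o iota).
Proof.
move=> bij_j jP bij_iota iotaD iotaM; have iota_inj := bij_inj bij_iota.
have E x y z : vcons (j (iota x)) (vcons (j (iota y)) (vcons (j (iota z))
    (@vnil M))) = j \o vcons (iota x) (vcons (iota y) (vcons (iota z) (@vnil N))).
  by rewrite !vcons_comp comp_vnil.
split; first exact: bij_comp.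
- exists (lift_formula 3 (Eq (tadd var0 var1) var2)) => x y z.
  rewrite E jP /= !evalE -iotaD.
  by split=> [/iota_inj|->].
- exists (lift_formula 3 (Eq (tmul var0 var1) var2)) => x y z.
  rewrite E jP /= !evalE -iotaM.
  by split=> [/iota_inj|->].
Qed.

Definition diff_reduct (M : structure diff_language) : structure ring_language :=
  @Structure ring_language M (carrier_inhabited M)
    (fun f => @func_interp _ M (Some f)) (fun r => match r with end).

Fixpoint diff_term (n : nat) (t : term ring_language n) : term diff_language n :=
  match t with
  | Var i => Var diff_language i
  | App f args => @App diff_language n (Some f) (fun j => diff_term (args j))
  end.

Fixpoint diff_formula (n : nat) (phi : formula ring_language n) :
    formula diff_language n :=
  match phi with
  | Bot n => Bot diff_language n
  | Eq n t1 t2 => Eq (diff_term t1) (diff_term t2)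
  | Rel n r args => match r with end
  | Imp n phi1 phi2 => Imp (diff_formula phi1) (diff_formula phi2)
  | All n phi1 => All (diff_formula phi1)
  end.

Lemma sat_diff_formula (M : structure diff_language) (n : nat)
    (phi : formula ring_language n) (v : 'I_n -> M) :
  sat (diff_formula phi) v <-> @sat _ (diff_reduct M) _ phi v.
Proof.
have E m (w : 'I_m -> M) t : eval w (diff_term t) = @eval _ (diff_reduct M) m w t.
  by elim: t => //= f args IH; congr func_interp; apply: funext => j; exact: IH.
elim: phi v => {n} [n|n t1 t2|n []|n phi1 IH1 phi2 IH2|n phi IH] v //=.
- by rewrite !E.
- by rewrite IH1 IH2.
- by split=> H a; apply/IH.
Qed.

Theorem corollary3p50 :
  (forall (L : language) (T : theory L) (kappa : Type) (M : structure L)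
      (cl : set M -> set M) (F : fieldType) (iota : F -> M),
    complete_theory T -> monster_model kappa T M ->
    existential_matroid kappa cl -> expands_field iota ->
    perfect_field F)
  /\
  (forall (p : nat) (T : theory ring_language) (kappa : Type)
      (M : structure ring_language) (cl : set M -> set M),
    completion (SCF_nonACF p) T -> monster_model kappa T M ->
    ~ existential_matroid kappa cl)
  /\
  (forall (p : nat) (T : theory diff_language) (kappa : Type)
      (M : structure diff_language) (cl : set M -> set M),
    prime p -> completion (DCF p) T -> monster_model kappa T M ->
    ~ existential_matroid kappa cl).
Proof.
split=> [L T kappa M cl F iota _ monM excl|].
  exact: existential_matroid_perfect monM excl.
split=> [p T kappa M cl [_ T0T] monM excl|p T kappa M cl p_pr [_ T0T] monM excl].
(* A separably closed field that is not algebraically closed is imperfect, so it satisfies every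
   sentence of [imperfect_theory p]. *)
- have modM : model (imperfect_theory p) M.
    move=> s sP; apply: (T0T s) (monster_is_model monM) => F cF scF nacF.
    by apply: sP => // perfF; apply: nacF; exact: separably_closed_perfect.
  have [F [iota [bij_iota iotaD iotaM]]] := imperfect_theory_field modM; apply.
  apply: (existential_matroid_perfect monM excl).
  apply: (@ring_reduct_expands _ M M _ iota (fun n phi => phi) id) => //.
  by exists id.
(* Here the translated sentences hold in every differentially closed field of characteristic [p],
   since its underlying field is imperfect. *)
- have modM : model (imperfect_theory p) (diff_reduct M).
    move=> s sP; apply/sat_diff_formula.
    apply: (T0T (diff_formula s)) (monster_is_model monM) => K d cK dcd.
    apply/sat_diff_formula; apply: sP => //.
    apply: differentially_closed_imperfect dcd.
    exact: has_characteristic_pchar cK p_pr.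
  have [F [iota [bij_iota iotaD iotaM]]] := imperfect_theory_field modM; apply.
  apply: (existential_matroid_perfect monM excl).
  apply: (@ring_reduct_expands _ M (diff_reduct M) _ iota diff_formula id) => //.
    by exists id.
  by move=> n phi v; exact: sat_diff_formula.
Qed.
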